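(* Let $E:\mathbb{R}^{n}\to\mathbb{R}$ be twice continuously differentiable, and let $V(\lambda_x,v)=\tfrac a2\lambda_x^T\lambda_x+\tfrac b2v^Tv+c\,\lambda_x^Tv$ with real numbers $a>0$, $b>0$, $c<0$, $ab-c^2>0$, be a CLF for the $(A_R)$-$(T_R)$ pair. Then Polyak's heavy ball equation can be generated from the minimum principle $(P_S)$, and also from the minimum principle $(P_S^* )$, using the Euclidean metric $W=I$ and this $V$. That is, for each of the two minimum principles, the free data (the function $\Delta>0$ in $(P_S)$, respectively the function $\rho\ge 0$ in $(P_S^* )$) can be chosen so that, for every trajectory $x(\cdot)$ of $\ddot x=u$, where $u$ is the control produced by the minimum principle with $v=\dot x$ and $\lambda_x=-\partial_xE(x)$, one has $$\ddot x+a_1(t)\,\dot x+a_2(t)\,\partial_xE(x)=0$$ for some time-varying scalar parameters $a_1(t)>0$ and $a_2(t)>0$.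
   Context: $\partial_xE$ and $\partial_x^2E$ denote the gradient and Hessian of $E$ on $\mathbb{R}^n$. The auxiliary system is $(A_R)$: $\dot\lambda_x=-\partial_x^2E(x)\,v$, $\dot v=u$, where $\lambda_x,v,u\in\mathbb{R}^n$ and $\dot x=v$; the target is $(T_R)$: $\lambda_x=0,\ v=0$. The Lie derivative of $V$ along the vector field $(-\partial_x^2E(x)v,\,u)$ is $$\pounds_fV=-\langle\partial_{\lambda_x}V(\lambda_x,v),\partial_x^2E(x)v\rangle+\langle\partial_vV(\lambda_x,v),u\rangle .$$ A control Lyapunov function (CLF) for $(A_R)$-$(T_R)$ is a positive definite function $V$ of $(\lambda_x,v)$ such that whenever $(\lambda_x,v)\ne(0,0)$ there is a choice of $u$ with $\pounds_fV<0$. Minimum principle $(P_S)$ (with metric $W=I$): at each $(x,\lambda_x,v,t)$ choose $u$ minimizing $\pounds_fV$ subject to $u^TWu\le\Delta(x,\lambda_x,v,t)$, where $\Delta$ is a positive real-valued function. Minimum principle $(P^*_S)$ (with metric $W=I$): at each $(x,\lambda_x,v,t)$ choose $u$ minimizing $\tfrac12u^TWu$ subject to $\pounds_fV+\rho(\lambda_x,v,x,t)\le0$, where $\rho$ is a nonnegative real-valued function. In both principles, the convention is that $u=0$ whenever $\partial_vV(\lambda_x,v)=0$. *)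

(* Defs.v *)
From HB Require Import structures.
From mathcomp Require Import all_boot all_order all_algebra.
From mathcomp Require Import all_classical all_reals all_analysis.
Set Implicit Arguments.
Unset Strict Implicit.
Unset Printing Implicit Defensive.
Import Order.TTheory GRing.Theory Num.Theory.
Import numFieldNormedType.Exports.
Local Open Scope classical_set_scope.
Local Open Scope ring_scope.

Section Calculus.
Context {R : realType} {n : nat}.
Implicit Types (f : 'cV[R]_n -> R) (x u v : 'cV[R]_n).

Definition dotp u v : R := (u^T *m v) 0 0.

Definition metric_sq (W : 'M[R]_n) u : R := (u^T *m W *m u) 0 0.

Definition gradient f x : 'cV[R]_n := \col_i 'D_(delta_mx i 0) f x.

Definition hessian f x : 'M[R]_n :=
  \matrix_(i, j) 'D_(delta_mx j 0) (fun y => gradient f y i 0) x.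

Definition twice_continuously_differentiable f : Prop :=
  [/\ forall x, differentiable f x,
      forall x, differentiable (gradient f) x
    & continuous (hessian f)].

(* One-sided at the endpoints of [D] that belong to [D]; the values of [f]
   outside [D] are irrelevant. *)
Definition derivative_within (D : set R) (f : R -> 'cV[R]_n) (t : R)
    (l : 'cV[R]_n) : Prop :=
  (s - t)^-1 *: (f s - f t) @[s --> within D t^'] --> l.

End Calculus.

Section AuxiliarySystem.
Context {R : realType} {n : nat}.
Implicit Types (E : 'cV[R]_n -> R) (V : 'cV[R]_n -> 'cV[R]_n -> R).
Implicit Types (x l v u : 'cV[R]_n) (t : R).

Definition grad_l V l v : 'cV[R]_n := gradient (fun l' => V l' v) l.
Definition grad_v V l v : 'cV[R]_n := gradient (fun v' => V l v') v.

(* Lie derivative of V along the vector field (- hessian E x *m v, u) of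
   the auxiliary system. *)
Definition lie E V x l v u : R :=
  - dotp (grad_l V l v) (hessian E x *m v) + dotp (grad_v V l v) u.

Definition positive_definite V : Prop :=
  V 0 0 = 0 /\ forall l v, (l, v) <> (0, 0) -> 0 < V l v.

(* V does not depend on x, so the decrease condition is required at every x. *)
Definition control_lyapunov E V : Prop :=
  positive_definite V /\
  forall x l v, (l, v) <> (0, 0) -> exists u, lie E V x l v u < 0.

(* [PS_control E V W Delta x l v t u]: the control u is chosen by (P_S) at
   (x, l, v, t); the last conjunct is the convention on u where the gradient
   of V in v vanishes. *)
Definition PS_control E V (W : 'M[R]_n)
    (Delta : 'cV[R]_n -> 'cV[R]_n -> 'cV[R]_n -> R -> R) x l v t u : Prop :=
  [/\ metric_sq W u <= Delta x l v t,
      forall u', metric_sq W u' <= Delta x l v t ->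
        lie E V x l v u <= lie E V x l v u'
    & grad_v V l v = 0 -> u = 0].

(* Same for (P*_S). *)
Definition PSstar_control E V (W : 'M[R]_n)
    (rho : 'cV[R]_n -> 'cV[R]_n -> 'cV[R]_n -> R -> R) x l v t u : Prop :=
  [/\ lie E V x l v u + rho l v x t <= 0,
      forall u', lie E V x l v u' + rho l v x t <= 0 ->
        2^-1 * metric_sq W u <= 2^-1 * metric_sq W u'
    & grad_v V l v = 0 -> u = 0].

(* [K x l v t u] reads "the principle chooses u at (x, l, v, t)".  The first
   clause says that the principle does produce a control, so that the second
   one is not satisfied through infeasibility.  Along a trajectory over the
   time interval I, v and w are the first and second derivatives of x. *)
Definition generates_heavy_ball E
    (K : 'cV[R]_n -> 'cV[R]_n -> 'cV[R]_n -> R -> 'cV[R]_n -> Prop) : Prop :=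
  (forall x l v t, exists! u, K x l v t u) /\
  forall (I : interval R) (x v w : R -> 'cV[R]_n),
    (forall t, t \in I -> derivative_within [set` I] x t (v t)) ->
    (forall t, t \in I -> derivative_within [set` I] v t (w t)) ->
    (forall t, t \in I -> K (x t) (- gradient E (x t)) (v t) t (w t)) ->
    exists a1 a2 : R -> R, forall t, t \in I ->
      [/\ 0 < a1 t, 0 < a2 t
        & w t + a1 t *: v t + a2 t *: gradient E (x t) = 0].

Definition quadratic_V (a b c : R) l v : R :=
  a / 2 * dotp l l + b / 2 * dotp v v + c * dotp l v.

End AuxiliarySystem.

(* Main.v *)
Require Import Defs.
From HB Require Import structures.
From mathcomp Require Import all_boot all_order all_algebra.
From mathcomp Require Import all_classical all_reals all_analysis.
From mathcomp Require Import ring lra.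
Set Implicit Arguments.
Unset Strict Implicit.
Unset Printing Implicit Defensive.
Import Order.TTheory GRing.Theory Num.Theory.
Import numFieldNormedType.Exports.
Local Open Scope classical_set_scope.
Local Open Scope ring_scope.

(** Write p for the gradient of V in v, which is [b *: v + c *: l].  Both
    principles steer against p.  Minimizing a linear form over a ball gives a
    control antiparallel to p, and so does minimizing the norm over a
    half-space with normal p.  So the control has the form [- k *: p] with a
    scalar k, and once l is minus the gradient of E this reads
    [u + (k * b) *: v + (- (k * c)) *: gradient E x = 0], a heavy ball equation
    with positive parameters as soon as [k > 0], because [b > 0 > c]
    ([feedback_generates_heavy_ball]).

    What remains is to choose the free data so that k is positive and the
    convention [u = 0] at [p = 0] is consistent with the principle.

    - For the ball, the squared radius [dotp p p] gives [k = 1]; at [p = 0] any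
      positive radius will do, since the objective is then constant and the
      convention alone selects the control ([PS_controlE]).

    - For the half-space, let L be the Lie derivative at zero control.  The
      choice [rho = `|L| + dotp p p] makes the constraint strictly active where
      [p != 0], with [k = 1 + (L + `|L|) / dotp p p].  Where [p = 0] the
      constraint does not involve u and amounts to [L <= 0]; this is exactly
      where the Lyapunov hypothesis enters, since no control can affect the Lie
      derivative there ([lie0_le0]). *)

(** * The Euclidean inner product *)

Section InnerProduct.
Context {R : realType} {n : nat}.
Implicit Types (u v w p : 'cV[R]_n) (s k : R).

Lemma dotpE u v : dotp u v = \sum_i u i 0 * v i 0.
Proof. by rewrite /dotp mxE; apply: eq_bigr => i _; rewrite mxE. Qed.

Lemma dotpC u v : dotp u v = dotp v u.
Proof. by rewrite !dotpE; apply: eq_bigr => i _; rewrite mulrC. Qed.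

Lemma dotpDr w u v : dotp w (u + v) = dotp w u + dotp w v.
Proof. by rewrite /dotp mulmxDr mxE. Qed.

Lemma dotpZr w k u : dotp w (k *: u) = k * dotp w u.
Proof. by rewrite /dotp -scalemxAr mxE. Qed.

Lemma dotpDl w u v : dotp (u + v) w = dotp u w + dotp v w.
Proof. by rewrite dotpC dotpDr !(dotpC w). Qed.

Lemma dotpZl w k u : dotp (k *: u) w = k * dotp u w.
Proof. by rewrite dotpC dotpZr (dotpC w). Qed.

Lemma dotp0r w : dotp w 0 = 0.
Proof. by rewrite /dotp mulmx0 mxE. Qed.

Lemma dotp0l w : dotp 0 w = 0.
Proof. by rewrite dotpC dotp0r. Qed.

Lemma dotp_delta i u : dotp (delta_mx i 0) u = u i 0.
Proof. by rewrite /dotp trmx_delta -rowE mxE. Qed.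

Lemma dotp_ge0 u : 0 <= dotp u u.
Proof. by rewrite dotpE; apply: sumr_ge0 => i _; rewrite -expr2 sqr_ge0. Qed.

Lemma dotp_eq0 u : (dotp u u == 0) = (u == 0).
Proof.
apply/idP/eqP => [|->]; last by rewrite dotp0r.
rewrite dotpE psumr_eq0 => [/allP u0|i _]; last by rewrite -expr2 sqr_ge0.
apply/matrixP => i j; rewrite (ord1 j) mxE.
by have := u0 i (mem_index_enum i); rewrite /= mulf_eq0 orbb => /eqP.
Qed.

Lemma dotp_gt0 u : (0 < dotp u u) = (u != 0).
Proof. by rewrite lt_def dotp_ge0 andbT dotp_eq0. Qed.

Lemma metric_sq1 u : metric_sq 1%:M u = dotp u u.
Proof. by rewrite /metric_sq mulmx1. Qed.

Lemma sqnorm_addZ k u p :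
  dotp (u + k *: p) (u + k *: p) =
  dotp u u + 2 * k * dotp p u + k ^+ 2 * dotp p p.
Proof. by rewrite dotpDr !dotpDl !dotpZr !dotpZl (dotpC u p); ring. Qed.

Lemma eq_opp_scale k u p :
  dotp (u + k *: p) (u + k *: p) <= 0 -> u = - k *: p.
Proof.
move=> le0; have: dotp (u + k *: p) (u + k *: p) == 0.
  by rewrite eq_le le0 dotp_ge0.
by rewrite dotp_eq0 addr_eq0 scaleNr => /eqP.
Qed.

(** Cauchy-Schwarz in the form of the expanded square of [u + p]; the case of
    equality is that this square vanishes. *)
Lemma ball_minimizerP p u :
  (dotp u u <= dotp p p /\
   forall u', dotp u' u' <= dotp p p -> dotp p u <= dotp p u') <-> u = - p.
Proof.
have sq w := sqnorm_addZ 1 w p; have sq_ge0 w := dotp_ge0 (w + 1 *: p).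
have pNp : dotp p (- p) = - dotp p p by rewrite -scaleN1r dotpZr mulN1r.
have NpNp : dotp (- p) (- p) = dotp p p.
  by rewrite -scaleN1r dotpZr dotpZl mulrA mulrNN !mul1r.
split=> [[uball umin]|->].
  have /umin : dotp (- p) (- p) <= dotp p p by rewrite NpNp.
  rewrite pNp => pu; rewrite -[in RHS](scale1r p) -scaleNr.
  by apply: eq_opp_scale; rewrite sq; lra.
split=> [|u' u'ball]; first by rewrite NpNp.
by rewrite pNp; have := sq_ge0 u'; rewrite sq; lra.
Qed.

(** The point of least norm in a half-space is the projection of the origin;
    here the half-space is parametrized so that this point is [- k *: p]. *)
Lemma halfspace_minimizerP p k u : 0 <= k ->
  (k * dotp p p + dotp p u <= 0 /\
   forall u', k * dotp p p + dotp p u' <= 0 -> dotp u u <= dotp u' u')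
  <-> u = - k *: p.
Proof.
move=> k0.
have pm : dotp p (- k *: p) = - (k * dotp p p) by rewrite dotpZr mulNr.
have mm : dotp (- k *: p) (- k *: p) = k ^+ 2 * dotp p p.
  by rewrite dotpZr dotpZl; ring.
have scaled w : k * dotp p p + dotp p w <= 0 ->
    k ^+ 2 * dotp p p + k * dotp p w <= 0.
  by move=> /(mulr_ge0_le0 k0); rewrite mulrDr mulrA -expr2.
split=> [[ufeas umin]|->].
  apply: eq_opp_scale; rewrite sqnorm_addZ.
  have /umin : k * dotp p p + dotp p (- k *: p) <= 0 by rewrite pm subrr.
  by rewrite mm; have := scaled _ ufeas; lra.
split=> [|u' /scaled u'feas]; first by rewrite pm subrr.
by rewrite mm; have := dotp_ge0 (u' + k *: p); rewrite sqnorm_addZ; lra.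
Qed.

End InnerProduct.

(** * The Lie derivative of the quadratic function *)

Section QuadraticGradient.
Context {R : realType} {n : nat}.
Implicit Types (f : 'cV[R]_n -> R) (x e l v : 'cV[R]_n).

(** The difference quotient is [d + h * q], so its limit can be read off. *)
Lemma derive_of_quadratic f x e (d q : R) :
  (forall h : R, f (h *: e + x) - f x = h * (d + h * q)) -> 'D_e f x = d.
Proof.
move=> fE; apply: cvg_lim => //.
have lim_d : (fun h : R => d + h * q) @ 0^' --> d.
  rewrite -[X in _ --> X]addr0 -[X in _ + X](mul0r q).
  apply: cvgD; first exact: cvg_cst.
  by apply: cvgM; [exact: nbhs_dnbhs | exact: cvg_cst].
apply: cvg_trans lim_d; apply: near_eq_cvg; near=> h.
have h0 : h != 0 by near: h; exact: nbhs_dnbhs_neq.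
by rewrite /= fE /GRing.scale /= mulKf.
Unshelve. all: by end_near. Qed.

Lemma grad_v_quadratic a b c l v :
  grad_v (quadratic_V a b c) l v = b *: v + c *: l.
Proof.
apply/matrixP => i j; rewrite (ord1 j) !mxE.
apply: (@derive_of_quadratic _ _ _ _ (b / 2)) => h.
rewrite /quadratic_V !dotpDr !dotpDl !dotpZr !dotpZl (dotpC v) (dotpC l).
by rewrite !dotp_delta !mxE !eqxx /=; field.
Qed.

Lemma lieE E a b c x l v u :
  lie E (quadratic_V a b c) x l v u =
  lie E (quadratic_V a b c) x l v 0 + dotp (b *: v + c *: l) u.
Proof. by rewrite /lie grad_v_quadratic dotp0r addr0. Qed.

Lemma lie_leE E a b c x l v u u' :
  (lie E (quadratic_V a b c) x l v u <= lie E (quadratic_V a b c) x l v u') =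
  (dotp (b *: v + c *: l) u <= dotp (b *: v + c *: l) u').
Proof. by rewrite (lieE _ _ _ _ _ _ _ u) (lieE _ _ _ _ _ _ _ u') lerD2l. Qed.

(** Where the gradient in v vanishes the control has no influence, so the
    decrease guaranteed by the Lyapunov condition already holds for [u = 0]. *)
Lemma lie0_le0 E a b c x l v :
  control_lyapunov E (quadratic_V a b c) -> b *: v + c *: l = 0 ->
  lie E (quadratic_V a b c) x l v 0 <= 0.
Proof.
move=> [_ decr] p0; have [[-> ->]|lv0] := pselect ((l, v) = (0, 0)).
  by rewrite /lie mulmx0 !dotp0r oppr0 addr0.
have [u] := decr x l v lv0.
by rewrite lieE p0 dotp0l addr0 => /ltW.
Qed.

End QuadraticGradient.

(** * The controls selected by the two principles *)

Section Controls.
Context {R : realType} {n : nat}.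
Context (E : 'cV[R]_n -> R) (a b c : R).
Implicit Types (x l v u : 'cV[R]_n) (t : R).

Let p l v : 'cV[R]_n := b *: v + c *: l.
Let V : 'cV[R]_n -> 'cV[R]_n -> R := quadratic_V a b c.
Let L x l v : R := lie E V x l v 0.

(** The indicator term only keeps the radius positive where [p l v = 0]. *)
Definition ball_radius_sq (x l v : 'cV[R]_n) (t : R) : R :=
  dotp (p l v) (p l v) + (p l v == 0)%:R.

Lemma ball_radius_sq_gt0 x l v t : 0 < ball_radius_sq x l v t.
Proof.
rewrite /ball_radius_sq; case: eqVneq => [->|p0].
  by rewrite dotp0r add0r.
by rewrite addr0 dotp_gt0.
Qed.

Lemma PS_controlE x l v t u :
  PS_control E V 1%:M ball_radius_sq x l v t u <-> u = - p l v.
Proof.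
rewrite /PS_control grad_v_quadratic metric_sq1 -/(p l v).
have [p0|pN0] := eqVneq (p l v) 0.
  rewrite p0 oppr0; split=> [[_ _ ->]//|->]; split=> //.
    by rewrite dotp0r ltW// ball_radius_sq_gt0.
  by move=> u' _; rewrite lie_leE -/(p l v) p0 !dotp0l.
have radE : ball_radius_sq x l v t = dotp (p l v) (p l v).
  by rewrite /ball_radius_sq (negPf pN0) addr0.
rewrite radE -ball_minimizerP; split=> [[uball umin _]|[uball umin]].
  split=> // u' u'ball.
  by move: (umin u'); rewrite metric_sq1 lie_leE; apply.
split=> // [u'|p0]; last by rewrite p0 eqxx in pN0.
by rewrite metric_sq1 lie_leE; exact: umin.
Qed.

Definition decay_rate (l v x : 'cV[R]_n) (t : R) : R :=
  `|L x l v| + dotp (p l v) (p l v).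

(** At [p l v = 0] the convention [0^-1 = 0] makes the gain 1. *)
Definition gain (x l v : 'cV[R]_n) : R :=
  1 + (L x l v + `|L x l v|) / dotp (p l v) (p l v).

Lemma decay_rate_ge0 l v x t : 0 <= decay_rate l v x t.
Proof. by rewrite addr_ge0 ?dotp_ge0. Qed.

Lemma gain_gt0 x l v : 0 < gain x l v.
Proof.
rewrite ltr_wpDr// divr_ge0 ?dotp_ge0//.
by rewrite -lerBlDl sub0r lerNl lerNnormlW.
Qed.

(** This puts the constraint in the form of [halfspace_minimizerP].  At
    [p l v = 0] it needs [L + `|L|] to vanish, which is [lie0_le0]. *)
Lemma lie_decay_rateE x l v t u :
  control_lyapunov E V ->
  lie E V x l v u + decay_rate l v x t =
  gain x l v * dotp (p l v) (p l v) + dotp (p l v) u.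
Proof.
move=> clf; rewrite lieE -/(p l v) -/(L x l v) /decay_rate /gain.
have [p0|pN0] := eqVneq (p l v) 0; last first.
  by rewrite mulrDl mul1r divfK ?dotp_eq0//; ring.
have L0 : L x l v <= 0 by exact: lie0_le0.
by rewrite p0 !dotp0l ler0_norm// mulr0 !addr0 subrr.
Qed.

Lemma PSstar_controlE x l v t u : control_lyapunov E V ->
  PSstar_control E V 1%:M decay_rate x l v t u <-> u = - gain x l v *: p l v.
Proof.
move=> clf; rewrite -(halfspace_minimizerP _ _ (ltW (gain_gt0 x l v))).
rewrite /PSstar_control grad_v_quadratic -/(p l v) metric_sq1.
rewrite lie_decay_rateE//.
split=> [[ufeas umin _]|/[dup] + [ufeas umin]].
  split=> // u' u'feas; move: (umin u').
  by rewrite lie_decay_rateE// metric_sq1 ler_pM2l// ?invr_gt0//; apply.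
move=> /(halfspace_minimizerP _ _ (ltW (gain_gt0 x l v))) uE.
split=> // [u'|p0]; last by rewrite uE p0 scaler0.
rewrite lie_decay_rateE// metric_sq1 ler_pM2l ?invr_gt0//; exact: umin.
Qed.

(** Substituting [l = - gradient E x] in [u = - k *: (b *: v + c *: l)] gives
    the friction [k * b] and the step [- (k * c)]. *)
Lemma feedback_generates_heavy_ball
    (K : 'cV[R]_n -> 'cV[R]_n -> 'cV[R]_n -> R -> 'cV[R]_n -> Prop)
    (k : 'cV[R]_n -> 'cV[R]_n -> 'cV[R]_n -> R) :
  0 < b -> c < 0 -> (forall x l v, 0 < k x l v) ->
  (forall x l v t u, K x l v t u <-> u = - k x l v *: p l v) ->
  generates_heavy_ball E K.
Proof.
move=> b0 c0 k0 KE; split=> [x l v t|J x v w _ _ wK].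
  by exists (- k x l v *: p l v); split=> [|u /KE//]; apply/KE.
pose kt t := k (x t) (- gradient E (x t)) (v t).
exists (fun t => kt t * b), (fun t => - (kt t * c)) => t tJ; split.
- by rewrite mulr_gt0// k0.
- by rewrite oppr_gt0 pmulr_rlt0// k0.
have /KE -> := wK t tJ; rewrite -/(kt t) /p.
by apply/matrixP => i j; rewrite !mxE; ring.
Qed.

End Controls.

Theorem corollary4p4 (R : realType) (n : nat) (E : 'cV[R]_n -> R)
    (a b c : R)
    (hE : twice_continuously_differentiable E)
    (ha : 0 < a) (hb : 0 < b) (hc : c < 0) (habc : 0 < a * b - c ^+ 2)
    (hV : control_lyapunov E (quadratic_V a b c)) :
  (exists Delta : 'cV[R]_n -> 'cV[R]_n -> 'cV[R]_n -> R -> R,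
     (forall x l v t, 0 < Delta x l v t) /\
     generates_heavy_ball E
       (PS_control E (quadratic_V a b c) 1%:M Delta)) /\
  (exists rho : 'cV[R]_n -> 'cV[R]_n -> 'cV[R]_n -> R -> R,
     (forall l v x t, 0 <= rho l v x t) /\
     generates_heavy_ball E
       (PSstar_control E (quadratic_V a b c) 1%:M rho)).
Proof.
split.
  exists (ball_radius_sq b c); split; first exact: ball_radius_sq_gt0.
  apply: (feedback_generates_heavy_ball E (k := fun _ _ _ => 1) hb hc) => //.
  by move=> x l v t u; rewrite scaleN1r; exact: PS_controlE.
exists (decay_rate E a b c); split; first exact: decay_rate_ge0.
apply: (feedback_generates_heavy_ball E (k := gain E a b c) hb hc).
- exact: gain_gt0.
- by move=> x l v t u; exact: PSstar_controlE.
Qed.
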